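(* Let $U\subseteq\mathbb{R}^d$ be open, $\tau>0$ and $\sigma>1$. Let $\mathcal{M}^{\tau,\sigma}:=\{M^{(c,\tau,\sigma)}:c>0\}$ with $M^{(c,\tau,\sigma)}_j:=c^{j^\sigma}j^{\tau j^\sigma}$, $j\in\mathbb{N}$ (with $0^0:=1$). Then, as locally convex vector spaces, $$\mathcal{E}_{\{\tau,\sigma\}}(U)=\mathcal{E}_{\{\mathcal{M}^{\tau,\sigma}\}}(U),\qquad \mathcal{E}_{(\tau,\sigma)}(U)=\mathcal{E}_{(\mathcal{M}^{\tau,\sigma})}(U).$$
   Context: $\mathbb{N}=\{0,1,2,\dots\}$. For a sufficiently regular compact $K\subset\mathbb{R}^d$ (smooth boundary, $\overline{K^\circ}=K$), $\mathcal{E}(K)$ denotes the smooth functions on $K$. $K\subset\subset U$ means that $K$ is a compact subset of $U$. Pilipović–Teofanov–Tomić classes: for $h>0$ let $\mathcal{E}_{\tau,\sigma,h}(K)$ be the Banach space of $f\in\mathcal{E}(K)$ with $\sup_{\alpha\in\mathbb{N}^d}\sup_{x\in K}\frac{|f^{(\alpha)}(x)|}{h^{|\alpha|^\sigma}|\alpha|^{\tau|\alpha|^\sigma}}<\infty$, and $$\mathcal{E}_{\{\tau,\sigma\}}(U)=\varprojlim_{K\subset\subset U}\varinjlim_{h\to\infty}\mathcal{E}_{\tau,\sigma,h}(K),\qquad \mathcal{E}_{(\tau,\sigma)}(U)=\varprojlim_{K\subset\subset U}\varprojlim_{h\to 0}\mathcal{E}_{\tau,\sigma,h}(K).$$ Weight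 matrix classes: for a family $\mathcal{M}=\{M^{(x)}:x>0\}$ of positive sequences pointwise non-decreasing in $x$, let $\mathcal{E}_{M^{(x)},h}(K)$ be the Banach space of $f\in\mathcal{E}(K)$ with $\sup_{\alpha\in\mathbb{N}^d,y\in K}\frac{|f^{(\alpha)}(y)|}{h^{|\alpha|}M^{(x)}_{|\alpha|}}<\infty$, and $$\mathcal{E}_{\{\mathcal{M}\}}(U)=\varprojlim_{K\subset\subset U}\varinjlim_{x>0}\varinjlim_{h>0}\mathcal{E}_{M^{(x)},h}(K),\qquad \mathcal{E}_{(\mathcal{M})}(U)=\varprojlim_{K\subset\subset U}\varprojlim_{x>0}\varprojlim_{h>0}\mathcal{E}_{M^{(x)},h}(K).$$ *)

(* Defs.v *)
From HB Require Import structures.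
From mathcomp Require Import all_boot all_order all_algebra.
From mathcomp Require Import all_classical all_reals all_analysis.
From mathcomp Require Import ring lra.

Set Implicit Arguments.
Unset Strict Implicit.
Unset Printing Implicit Defensive.

Import Order.TTheory GRing.Theory Num.Theory.
Import numFieldNormedType.Exports.

Local Open Scope classical_set_scope.
Local Open Scope ring_scope.

Section LocallyConvexSubspaces.
Context {R : realType} {X : lmodType R}.

Definition linear_subspace (A : set X) : Prop :=
  A 0 /\ forall (a : R) u v, A u -> A v -> A (a *: u + v).

Definition disk (W : set X) : Prop :=
  W 0 /\ forall (a b : R) u v, `|a| + `|b| <= 1 -> W u -> W v ->
    W (a *: u + b *: v).

Definition absorbs (N : set X) (x : X) : Prop :=
  exists2 r : R, 0 < r & forall a : R, `|a| <= r -> N (a *: x).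

(* A linear subspace of [X] with a locally convex vector space topology, given
   by its filter of neighborhoods of 0; [N : set X] is a neighborhood when its
   trace on the carrier is one.  The fields are the usual conditions for a
   filter to come from such a topology, and [lcs_space] below is the resulting
   [tvsType].  Carriers lie in a common [X] so that two locally convex spaces
   can be compared by [=]: by [lcs_eq] this means same vectors, same topology. *)
Record lcs := Lcs {
  carrier : set X ;
  nbhs0 : set_system X ;
  carrier_subspace : linear_subspace carrier ;
  nbhs0_filter : Filter nbhs0 ;
  nbhs0_carrier : nbhs0 carrier ;
  nbhs0_disk : forall N, nbhs0 N -> exists W, [/\ nbhs0 W, disk W & W `<=` N] ;
  nbhs0_scale : forall N (a : R), nbhs0 N -> nbhs0 [set x | N (a *: x)] ;
  nbhs0_absorbs : forall N x, nbhs0 N -> carrier x -> absorbs N x }.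
#[local] Existing Instance nbhs0_filter.

Lemma lcs_eq (E F : lcs) :
  carrier E = carrier F -> nbhs0 E = nbhs0 F -> E = F.
Proof.
case: E => A P p1 p2 p3 p4 p5 p6; case: F => B Q q1 q2 q3 q4 q5 q6 /= eA eP.
by subst B Q; congr Lcs; exact: Prop_irrelevance.
Qed.

Definition cont_incl (E F : lcs) : Prop :=
  carrier E `<=` carrier F /\ nbhs0 F `<=` nbhs0 E.

Lemma disk0 W : disk W -> W 0. Proof. by case. Qed.

Lemma diskI W V : disk W -> disk V -> disk (W `&` V).
Proof.
move=> [W0 Wd] [V0 Vd]; split=> // a b u v ab [Wu Vu] [Wv Vv].
by split; [exact: Wd|exact: Vd].
Qed.

Lemma subspace_disk A : linear_subspace A -> disk A.
Proof.
move=> [A0 Al]; split=> // a b u v _ Au Av; apply: (Al) => //.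
by rewrite -[b *: v]addr0; apply: (Al).
Qed.

Lemma disk_scale W (r : R) : disk W -> disk [set x | W (r *: x)].
Proof.
move=> [W0 Wd]; split=> /= [|a b u v ab Wu Wv]; first by rewrite scaler0.
by rewrite scalerDr !scalerA ![r * _]mulrC -!scalerA; exact: Wd.
Qed.

Section Seminorm.
Variables (A : set X) (p : X -> R).
Hypothesis Asub : linear_subspace A.
Hypothesis pD : forall u v, A u -> A v -> p (u + v) <= p u + p v.
Hypothesis pZ : forall (a : R) u, A u -> p (a *: u) = `|a| * p u.

Definition seminorm_nbhs0 : set_system X :=
  [set N | exists2 e : R, 0 < e & [set x | A x /\ p x < e] `<=` N].

Let p_ge0 u : A u -> 0 <= p u.
Proof.
move=> Au; have p0 : p 0 = 0 by rewrite -(scale0r u) pZ// normr0 mul0r.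
have ANu : A (- u).
  by rewrite -[- u]addr0 -scaleN1r; apply: Asub.2 => //; exact: Asub.1.
have := pD Au ANu; rewrite subrr p0 -scaleN1r pZ// normrN1 mul1r; lra.
Qed.

Let AZ (a : R) u : A u -> A (a *: u).
Proof.
by move=> Au; rewrite -[_ *: _]addr0; apply: Asub.2 => //; exact: Asub.1.
Qed.

Lemma seminorm_nbhs0_filter : Filter seminorm_nbhs0.
Proof.
split; first by exists 1.
- move=> P Q [e e0 eP] [f f0 fQ]; exists (Num.min e f).
    by rewrite lt_min e0.
  by move=> x [Ax]; rewrite lt_min => /andP[pe pf]; split;
    [exact: eP|exact: fQ].
- by move=> P Q PQ [e e0 eP]; exists e => // x /eP /PQ.
Qed.

Lemma seminorm_carrier : seminorm_nbhs0 A.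
Proof. by exists 1 => // x []. Qed.

Lemma seminorm_disk N : seminorm_nbhs0 N ->
  exists W, [/\ seminorm_nbhs0 W, disk W & W `<=` N].
Proof.
move=> [e e0 eN]; exists [set x | A x /\ p x < e]; split=> //; first by exists e.
split=> /=.
  case: (Asub) => A0 _; split=> //.
  by rewrite -(scale0r 0) pZ// normr0 mul0r.
move=> a b u v ab [Au pu] [Av pv]; split.
  by case: Asub => _; apply=> //; exact: AZ.
apply: (le_lt_trans (pD (AZ a Au) (AZ b Av))); rewrite !pZ//.
have [m [m0 me um vm]] : exists m, [/\ 0 <= m, m < e, p u <= m & p v <= m].
  exists (Num.max (p u) (p v)); split.
  - by rewrite le_max p_ge0.
  - by rewrite gt_max pu.
  - by rewrite le_max lexx.
  - by rewrite le_max lexx orbT.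
have h1 : `|a| * p u <= `|a| * m by exact: ler_wpM2l.
have h2 : `|b| * p v <= `|b| * m by exact: ler_wpM2l.
have h3 : (`|a| + `|b|) * m <= 1 * m by exact: ler_wpM2r.
by rewrite mulrDl mul1r in h3; lra.
Qed.

Lemma seminorm_scale N (a : R) :
  seminorm_nbhs0 N -> seminorm_nbhs0 [set x | N (a *: x)].
Proof.
move=> [e e0 eN]; have a1 : 0 < `|a| + 1 by rewrite ltr_wpDl.
exists (e / (`|a| + 1)); first by rewrite divr_gt0.
move=> x [Ax px] /=; apply: eN; split; first exact: AZ.
rewrite pZ//; move: px; rewrite ltr_pdivlMr// => px.
by apply: le_lt_trans px; rewrite mulrC ler_wpM2l ?p_ge0// lerDl.
Qed.

Lemma seminorm_absorbs N x : seminorm_nbhs0 N -> A x -> absorbs N x.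
Proof.
move=> [e e0 eN] Ax; have p1 : 0 < p x + 1 by rewrite ltr_wpDl ?p_ge0.
exists (e / (p x + 1)); first by rewrite divr_gt0.
move=> a; rewrite ler_pdivlMr// => ae; apply: eN; split; first exact: AZ.
rewrite pZ//; have [->|a0] := eqVneq a 0; first by rewrite normr0 mul0r.
by apply: lt_le_trans ae; rewrite ltr_pM2l ?normr_gt0// ltrDl.
Qed.

Definition seminorm_lcs : lcs :=
  Lcs Asub seminorm_nbhs0_filter seminorm_carrier seminorm_disk seminorm_scale
    seminorm_absorbs.

End Seminorm.

(* Inductive limit along inclusions.  The carrier is the linear span of the
   union, that is the union itself when the family is directed
   ([ind_lim_directed]); the topology is the finest locally convex one for which
   all the inclusions are continuous ([ind_limP]). *)
Section InductiveLimit.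
Variables (I : Type) (E : I -> lcs).

Definition ind_carrier : set X :=
  smallest linear_subspace (\bigcup_i carrier (E i)).

Definition ind_nbhs0 : set_system X :=
  [set N | exists W, [/\ disk W, forall i, nbhs0 (E i) W & W `<=` N]].

Lemma ind_carrier_subspace : linear_subspace ind_carrier.
Proof.
split; first by move=> B [[B0 _] _].
move=> a u v Au Av B BE; apply: BE.1.2; [exact: (Au B BE)|exact: (Av B BE)].
Qed.

Let sub_ind i : carrier (E i) `<=` ind_carrier.
Proof. by move=> x Ex; apply: sub_gen_smallest; exists i. Qed.

Lemma ind_filter : Filter ind_nbhs0.
Proof.
split.
- by exists setT; split=> // i; exact: filterT.
- move=> P Q [W [Wd WE WP]] [V [Vd VE VQ]]; exists (W `&` V); split.
  + exact: diskI.
  + by move=> i; exact: filterI.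
  + by move=> x [/WP ? /VQ ?].
- by move=> P Q PQ [W [Wd WE WP]]; exists W; split=> // x /WP /PQ.
Qed.

Lemma ind_nbhs0_carrier : ind_nbhs0 ind_carrier.
Proof.
exists ind_carrier; split=> //; first exact/subspace_disk/ind_carrier_subspace.
by move=> i; apply: (filterS (@sub_ind i)); exact: nbhs0_carrier.
Qed.

Lemma ind_disk N : ind_nbhs0 N ->
  exists W, [/\ ind_nbhs0 W, disk W & W `<=` N].
Proof. by move=> [W [Wd WE WN]]; exists W; split=> //; exists W; split. Qed.

Lemma ind_scale N (a : R) : ind_nbhs0 N -> ind_nbhs0 [set x | N (a *: x)].
Proof.
move=> [W [Wd WE WN]]; exists [set x | W (a *: x)]; split=> //.
- exact: disk_scale.
- by move=> i; exact: nbhs0_scale.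
- by move=> x /WN.
Qed.

Lemma ind_absorbs N x : ind_nbhs0 N -> ind_carrier x -> absorbs N x.
Proof.
move=> [W [Wd WE WN]] xI.
suff [r r0 rW] : absorbs W x by exists r => // a /rW /WN.
apply: (xI (absorbs W)); split; last first.
  by move=> y [i _ Ey]; exact: nbhs0_absorbs (WE i) Ey.
split; first by exists 1 => // a _; rewrite scaler0; exact: disk0.
move=> b u v [r r0 rW] [s s0 sW].
have b1 : 0 < `|b| + 1 by rewrite ltr_wpDl.
exists (Num.min (r / (`|b| + 1)) s / 2).
  by rewrite divr_gt0// lt_min s0 divr_gt0.
move=> a; rewrite ler_pdivlMr// le_min => /andP[].
rewrite ler_pdivlMr// => ar as_.
have -> : a *: (b *: u + v) =
    2^-1 *: ((a * 2 * b) *: u) + 2^-1 *: ((a * 2) *: v).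
  by rewrite scalerDr !scalerA; congr (_ *: _ + _ *: _); field.
apply: Wd.2.
- by rewrite !ger0_norm//; lra.
- apply: rW; rewrite !normrM; apply: le_trans ar.
  by rewrite [`|2|]ger0_norm// ler_wpM2l ?mulr_ge0// lerDl.
- by apply: sW; rewrite normrM [`|2|]ger0_norm.
Qed.

Definition ind_lim : lcs :=
  Lcs ind_carrier_subspace ind_filter ind_nbhs0_carrier ind_disk ind_scale
    ind_absorbs.

Lemma ind_limP (F : lcs) :
  cont_incl ind_lim F <-> forall i, cont_incl (E i) F.
Proof.
split=> [[EF FE] i|EF].
  split=> [x /sub_ind /EF//|N /FE [W [_ WE WN]]].
  exact: filterS WN (WE i).
split=> [x|N].
  apply; split; first exact: carrier_subspace.
  by move=> y [i _ Ey]; exact: (EF i).1.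
move=> /nbhs0_disk [W [FW Wd WN]]; exists W; split=> // i; exact: (EF i).2.
Qed.

Lemma ind_lim_directed : inhabited I ->
  (forall i j, exists k, carrier (E i) `|` carrier (E j) `<=` carrier (E k)) ->
  carrier ind_lim = \bigcup_i carrier (E i).
Proof.
move=> [i0] dir; apply: smallest_id; split.
  by exists i0 => //; exact: (carrier_subspace _).1.
move=> a u v [i _ Eu] [j _ Ev]; have [k ijk] := dir i j.
by exists k => //; apply: (carrier_subspace _).2; apply: ijk; [left|right].
Qed.

End InductiveLimit.

(* Projective limit, realized inside a given subspace [S]: the vectors of [S]
   that every [rho i] sends into [E i], with the coarsest topology that makes
   all the [rho i] continuous ([proj_limP]). *)
Section ProjectiveLimit.
Variables (S : set X) (Ssub : linear_subspace S).
Variables (I : Type) (E : I -> lcs) (rho : I -> {linear X -> X}).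

Definition proj_carrier : set X :=
  [set x | S x /\ forall i, carrier (E i) (rho i x)].

Definition proj_nbhs0 : set_system X :=
  smallest Filter
    [set N | N = proj_carrier \/
       exists i, exists2 M, nbhs0 (E i) M & N = rho i @^-1` M].

#[local] Instance proj_filter : Filter proj_nbhs0.
Proof. exact: smallest_filter_filter. Qed.

Lemma proj_carrier_subspace : linear_subspace proj_carrier.
Proof.
split=> [|a u v [Su Eu] [Sv Ev]]; split.
- exact: Ssub.1.
- by move=> i; rewrite linear0; exact: (carrier_subspace _).1.
- exact: Ssub.2.
- by move=> i; rewrite linearP; exact: (carrier_subspace _).2.
Qed.

Lemma proj_nbhs0_carrier : proj_nbhs0 proj_carrier.
Proof. by apply: sub_gen_smallest; left. Qed.

Let proj_nbhs0_preim i M : nbhs0 (E i) M -> proj_nbhs0 (rho i @^-1` M).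
Proof. by move=> EM; apply: sub_gen_smallest; right; exists i, M. Qed.

Lemma proj_disk N : proj_nbhs0 N ->
  exists W, [/\ proj_nbhs0 W, disk W & W `<=` N].
Proof.
move: N; apply: smallest_sub.
  split.
  - by exists setT; split=> //; exact: filterT.
  - move=> P Q [W [W1 W2 W3]] [V [V1 V2 V3]]; exists (W `&` V); split.
    + exact: (filterI W1 V1).
    + exact: diskI.
    + by move=> x [/W3 ? /V3 ?].
  - by move=> P Q PQ [W [W1 W2 W3]]; exists W; split=> // x /W3 /PQ.
move=> N /= [->|[i [M EM ->]]].
  exists proj_carrier; split=> //; first exact: proj_nbhs0_carrier.
  exact/subspace_disk/proj_carrier_subspace.
have [W [EW [W0 Wd] WM]] := nbhs0_disk EM.
exists (rho i @^-1` W); split; first exact: proj_nbhs0_preim.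
  split=> [|a b u v ab Wu Wv] /=; first by rewrite linear0.
  by rewrite linearD !linearZ; exact: Wd.
by move=> x /WM.
Qed.

Lemma proj_scale N (a : R) : proj_nbhs0 N -> proj_nbhs0 [set x | N (a *: x)].
Proof.
move: N.
apply: (@smallest_sub _ Filter _ [set N | proj_nbhs0 [set x | N (a *: x)]]).
move=> N /= [->|[i [M EM ->]]].
  apply: (filterS (F := proj_nbhs0) _ proj_nbhs0_carrier) => x Ex /=.
  by rewrite -[_ *: _]addr0; apply: proj_carrier_subspace.2 => //;
    exact: proj_carrier_subspace.1.
have := proj_nbhs0_preim (nbhs0_scale a EM).
by apply: (filterS (F := proj_nbhs0)) => x /=; rewrite linearZ.
Qed.

Lemma proj_absorbs N x : proj_nbhs0 N -> proj_carrier x -> absorbs N x.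
Proof.
move=> + Ex; move: N.
apply: (@smallest_sub _ Filter _ [set N | absorbs N x]).
  split.
  - by exists 1.
  - move=> P Q [r r0 rP] [s s0 sQ]; exists (Num.min r s); first by rewrite lt_min r0.
    by move=> a; rewrite le_min => /andP[/rP ? /sQ ?].
  - by move=> P Q PQ [r r0 rP]; exists r => // a /rP /PQ.
move=> N /= [->|[i [M EM ->]]].
  exists 1 => // a _; rewrite -[_ *: _]addr0; apply: proj_carrier_subspace.2 => //.
  exact: proj_carrier_subspace.1.
have [r r0 rM] := nbhs0_absorbs EM (Ex.2 i).
by exists r => // a /rM /=; rewrite linearZ.
Qed.

Definition proj_lim : lcs :=
  Lcs proj_carrier_subspace proj_filter proj_nbhs0_carrier
    proj_disk proj_scale proj_absorbs.

Lemma proj_limP (F : lcs) : carrier F `<=` S ->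
  cont_incl F proj_lim <->
  forall i, carrier F `<=` rho i @^-1` carrier (E i) /\
    forall M, nbhs0 (E i) M -> nbhs0 F (rho i @^-1` M).
Proof.
move=> FS; split=> [[FP PF] i|H].
  split=> [x /FP[_ Ex]|M EM]; first exact: Ex.
  exact: (PF _ (proj_nbhs0_preim EM)).
have FP : carrier F `<=` carrier proj_lim.
  by move=> x Fx; split=> [|i]; [exact: FS|exact: (H i).1].
split=> //; apply: smallest_sub.
move=> N /= [->|[i [M EM ->]]]; last exact: (H i).2.
exact: filterS FP (nbhs0_carrier F).
Qed.

End ProjectiveLimit.

End LocallyConvexSubspaces.
Arguments lcs {R} X.

Section LcsSpace.
Context {R : realType} {X : lmodType R} (E : lcs X).
#[local] Existing Instance nbhs0_filter.

Definition in_carrier : {pred X} := [pred x | x \in carrier E].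

Definition lcs_space : Type := {x : X | x \in in_carrier}.

Fact in_carrier_submod : subsemimod_closed in_carrier.
Proof.
have [C0 CP] := carrier_subspace E.
split=> [|a u] /=; first split.
- by rewrite !inE.
- move=> u v; rewrite !inE => Cu Cv.
  by rewrite -[u]scale1r; exact: CP.
- rewrite !inE => Cu; rewrite -[_ *: _]addr0; exact: CP.
Qed.

HB.instance Definition _ := [isSub of lcs_space for @sval _ _].
HB.instance Definition _ := [Choice of lcs_space by <:].
HB.instance Definition _ :=
  GRing.SubChoice_isSubLmodule.Build R X in_carrier lcs_space in_carrier_submod.

Definition lcs_nbhs (x : lcs_space) : set_system lcs_space :=
  [set B | exists2 N, nbhs0 E N & forall y, N (\val y - \val x) -> B y].

HB.instance Definition _ := hasNbhs.Build lcs_space lcs_nbhs.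

Let carrierP (x : lcs_space) : carrier E (\val x).
Proof. by have := valP x; rewrite !inE. Qed.

Let half_disk N : nbhs0 E N -> exists V, [/\ nbhs0 E V, disk V &
  forall x y, V x -> V y -> N (x + y)].
Proof.
move=> /nbhs0_disk[W [EW Wd WN]]; exists [set x | W (2 *: x)]; split.
- exact: nbhs0_scale.
- exact: disk_scale.
- move=> x y Wx Wy; apply: WN.
  have -> : x + y = 2^-1 *: (2 *: x) + 2^-1 *: (2 *: y).
    by rewrite !scalerA mulVf ?scale1r.
  by apply: Wd.2 => //; rewrite !ger0_norm//; lra.
Qed.

Let lcs_nbhs_filter (x : lcs_space) : ProperFilter (nbhs x).
Proof.
split.
  move=> [N EN]; move=> /(_ x); apply; rewrite subrr.
  have [W [_ [W0 _] WN]] := nbhs0_disk EN.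
  exact: WN.
split.
- by exists setT => //; exact: filterT.
- move=> P Q [N EN NP] [M EM MQ]; exists (N `&` M); first exact: filterI.
  by move=> y [/NP ? /MQ ?].
- by move=> P Q PQ [N EN NP]; exists N => // y /NP /PQ.
Qed.

Let lcs_nbhs_singleton (x : lcs_space) (A : set lcs_space) : nbhs x A -> A x.
Proof.
move=> [N EN]; apply; rewrite subrr.
have [W [_ [W0 _] WN]] := nbhs0_disk EN.
exact: WN.
Qed.

Let lcs_nbhs_nbhs (x : lcs_space) (A : set lcs_space) :
  nbhs x A -> nbhs x (nbhs^~ A).
Proof.
move=> [N /half_disk[V [EV _ VN]] NA]; exists V => // y Vyx; exists V => // z Vzy.
by apply: NA; have := VN _ _ Vzy Vyx; rewrite addrA subrK.
Qed.

HB.instance Definition _ := Nbhs_isNbhsTopological.Build lcs_space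
  lcs_nbhs_filter lcs_nbhs_singleton lcs_nbhs_nbhs.

Let lcs_add_continuous : continuous (fun x : lcs_space * lcs_space => x.1 + x.2).
Proof.
move=> [x y] A [N /half_disk[V [EV _ VN]] NA].
exists ([set z : lcs_space | V (\val z - \val x)], [set z : lcs_space | V (\val z - \val y)]).
  by split; exists V.
move=> [z t] [/= Vz Vt]; apply: NA => /=.
have := VN _ _ Vz Vt; congr N.
by rewrite addrACA -opprD.
Qed.

Let lcs_scale_continuous : continuous (fun z : R^o * lcs_space => z.1 *: z.2).
Proof.
move=> [a x] A [N /half_disk[V [EV [V0 Vd] VN]] NA].
have [r r0 rV] := nbhs0_absorbs EV (carrierP x).
have a1 : 0 < `|a| + 1 by rewrite ltr_wpDl.
pose M := [set z | V ((`|a| + 1) *: z)].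
have EM : nbhs0 E M by exact: nbhs0_scale.
exists ([set b : R^o | `|b - a| <= Num.min r 1],
        [set z : lcs_space | M (\val z - \val x)]).
  split; last by exists M.
  apply/nbhs_ballP; exists (Num.min r 1) => /=; first by rewrite lt_min r0 /=.
  by move=> b; rewrite /ball/= distrC => /ltW.
move=> [b y] [/=]; rewrite le_min => /andP[bar ba1] My; apply: NA => /=.
have -> : b *: \val y - a *: \val x =
    b *: (\val y - \val x) + (b - a) *: \val x.
  by rewrite scalerBr scalerBl addrA subrK.
apply: VN; last exact: rV.
have -> : b *: (\val y - \val x) =
    (b / (`|a| + 1)) *: ((`|a| + 1) *: (\val y - \val x)) + 0 *: 0.
  by rewrite scale0r addr0 scalerA divfK// gt_eqF.
apply: Vd => //; rewrite normr0 addr0 normrM normfV (ger0_norm (ltW a1)).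
rewrite ler_pdivrMr// mul1r -lerBlDl; apply: le_trans ba1.
exact: lerB_dist.
Qed.

Let lcs_locally_convex : exists2 B : set_system lcs_space,
  (forall b, b \in B -> convex_set b) & basis B.
Proof.
exists [set b : set lcs_space | open b /\ convex_set b].
  by move=> b; rewrite inE => -[].
split; first by move=> b [].
move=> x A [N EN NA].
have [W [EW [W0 Wd] WN]] := nbhs0_disk EN.
pose C := [set y : lcs_space | W (\val y - \val x)].
have nC : nbhs x C by exists W.
exists C°; last first.
  by move=> y /nbhs_singleton Cy; exact/NA/WN.
split; last exact: nC.
split; first exact: open_interior.
move=> u v l; rewrite !inE => -[N1 E1 N1C] [N2 E2 N2C].
exists (N1 `&` N2); first exact: filterI.
move=> y [].
have [a [b [a0 b0 ab ->]]] : exists a b : R, [/\ 0 <= a, 0 <= b, a + b = 1 &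
    conv l u v = a *: u + b *: v :> lcs_space].
  by exists l%:num, (1 - l%:num); split; rewrite ?subr_ge0// addrC subrK.
set c := a *: u + b *: v => y1 y2.
have Cu : C (u + (y - c)) by apply: N1C; rewrite /= addrAC subrr add0r.
have Cv : C (v + (y - c)) by apply: N2C; rewrite /= addrAC subrr add0r.
rewrite /C /=.
have -> : \val y - \val x = a *: (\val (u + (y - c)) - \val x) +
    b *: (\val (v + (y - c)) - \val x).
  have sD (t : lcs_space) : \val (t + (y - c)) - \val x =
    \val t + (\val y - \val c - \val x) by rewrite -!addrA.
  rewrite !{}sD [in RHS](scalerDr a) (scalerDr b) addrACA -scalerDl ab scale1r.
  have -> : a *: \val u + b *: \val v = \val c by [].
  by rewrite addrA addrCA subrr addr0.
by apply: Wd => //; rewrite !ger0_norm// ab.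
Qed.

HB.instance Definition _ := PreTopologicalLmod_isTvs.Build R lcs_space
  lcs_add_continuous lcs_scale_continuous lcs_locally_convex.
HB.instance Definition _ :=
  PreTopologicalNmodule_isTopologicalNmodule.Build lcs_space lcs_add_continuous.
HB.instance Definition _ :=
  TopologicalNmodule_isTopologicalLmodule.Build R lcs_space lcs_scale_continuous.
HB.instance Definition _ :=
  Uniform_isTvs.Build R lcs_space lcs_locally_convex.

End LcsSpace.

Section SmoothFunctions.
Context {R : realType} {d : nat}.

Definition iter_partial {W : normedModType R} (s : seq 'I_d)
    (f : 'rV[R]_d -> W) : 'rV[R]_d -> W :=
  foldr (fun i g => 'D_(delta_mx 0 i) g) f s.

Definition smooth_on {W : normedModType R} (O : set 'rV[R]_d)
    (f : 'rV[R]_d -> W) : Prop :=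
  forall (s : seq 'I_d) x, O x -> {for x, continuous (iter_partial s f)} /\
    forall i, derivable (iter_partial s f) x (delta_mx 0 i).

Definition multi_index := {ffun 'I_d -> nat}.

Definition mi_length (alpha : multi_index) : nat := (\sum_i alpha i)%N.

Definition mderiv {W : normedModType R} (alpha : multi_index)
    (f : 'rV[R]_d -> W) : 'rV[R]_d -> W :=
  iter_partial (flatten [seq nseq (alpha i) i | i <- enum 'I_d]) f.

Section Linearity.
Context {W : normedModType R} {O : set 'rV[R]_d} (oO : open O).
Context {f g : 'rV[R]_d -> W} (a : R).
Hypotheses (sf : smooth_on O f) (sg : smooth_on O g).

Lemma iter_partialP s x : O x ->
  iter_partial s (a *: f + g) x = a *: iter_partial s f x + iter_partial s g x.
Proof.
elim: s x => [//|i s IH] x Ox /=.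
rewrite (@near_eq_derive _ _ _ _ (a *: iter_partial s f + iter_partial s g)).
  have df := (sf s Ox).2 i; have dg := (sg s Ox).2 i.
  have adf : derivable (a *: iter_partial s f) x (delta_mx 0 i).
    exact: derivableZ.
  by rewrite (deriveD adf dg); congr (_ + _); exact: deriveZ.
near=> y; apply: IH; near: y; exact: open_nbhs_nbhs.
Unshelve. all: by end_near. Qed.

Lemma smooth_onP : smooth_on O (a *: f + g).
Proof.
move=> s x Ox.
have E : {near x, iter_partial s (a *: f + g) =1
    a *: iter_partial s f + iter_partial s g}.
  by near=> y; apply: iter_partialP; near: y; exact: open_nbhs_nbhs.
have E' : {near x, a *: iter_partial s f + iter_partial s g =1
    iter_partial s (a *: f + g)}.
  by apply: filterS E => y ->.
split=> [|i].
  rewrite /prop_for /continuous_at (nbhs_singleton E).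
  apply: (cvg_trans (near_eq_cvg E')).
  apply: (@cvgD _ _ _ (nbhs x)); last exact: (sg s Ox).1.
  by apply: cvgZl_tmp; exact: (sf s Ox).1.
apply: near_eq_derivable E' _.
apply: derivableD; last exact: (sg s Ox).2.
by apply: derivableZ; exact: (sf s Ox).2.
Unshelve. all: by end_near. Qed.

End Linearity.

Lemma iter_partial0 {W : normedModType R} s :
  iter_partial s (0 : 'rV[R]_d -> W) = 0.
Proof.
elim: s => //= i s ->; apply/funext => x; exact: derive_cst.
Qed.

Lemma smooth_on0 {W : normedModType R} O : smooth_on O (0 : 'rV[R]_d -> W).
Proof.
move=> s x _; rewrite iter_partial0; split; first exact: (@cst_continuous _ _ 0 x).
by move=> i; exact: derivable_cst.
Qed.

End SmoothFunctions.

(* near each of its boundary points, [K] is the set of nonpositivity of a smooth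
   function with nonzero gradient *)
Definition smooth_boundary {R : realType} {d : nat} (K : set 'rV[R]_d) : Prop :=
  forall p, (K `\` K°) p ->
  exists V : set 'rV[R]_d, exists phi : 'rV[R]_d -> R^o,
    [/\ open V, V p, smooth_on V phi,
        exists i : 'I_d, 'D_(delta_mx 0 i) phi p != 0 &
        K `&` V = [set x | phi x <= 0] `&` V].

Record regular_compact (R : realType) (d : nat) := RegularCompact {
  rc_set :> set 'rV[R]_d ;
  rc_compact : compact rc_set ;
  rc_closure : closure (rc_set°) = rc_set ;
  rc_boundary : smooth_boundary rc_set }.

(* The functions take their values in a real Banach space [F]: [F = R^o] gives
   real-valued functions, and complex-valued ones are obtained by viewing the
   field of complex numbers as a real Banach space; locally convex inductive and
   projective limits do not depend on the choice of the scalar field. *)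
Section FunctionSpaces.
Context {R : realType} {d : nat} {F : completeNormedModType R}.
Local Notation V := ('rV[R]_d).
Local Notation X := (V -> F).

(* A function on a set [A] is represented by its extension by 0 outside [A];
   so all the spaces below are subspaces of [X], and [restr A] is the
   restriction to [A]. *)
Definition restr (A : set V) (f : X) : X := patch (cst 0) A f.

Fact restr_linear A : linear (restr A).
Proof.
move=> a f g; apply/funext => x; rewrite /restr.
rewrite /GRing.add /GRing.scale /= /patch.
by case: ifP => // _; rewrite scaler0 addr0.
Qed.

HB.instance Definition _ A :=
  GRing.isLinear.Build R X X *:%R (restr A) (restr_linear A).

Definition smooth_space (U : set V) : set X :=
  [set f | restr U f = f /\ smooth_on U f].

Lemma smooth_space_subspace U : open U -> linear_subspace (smooth_space U).
Proof.
move=> oU; split=> [|a f g [rf sf] [rg sg]]; split.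
- exact: (linear0 (restr _)).
- exact: smooth_on0.
- by rewrite restr_linear rf rg.
- exact: smooth_onP.
Qed.

(* Derivatives on a compact set [K] that is the closure of its interior are
   computed in the interior and extended to [K] by continuity. *)
Definition mderiv_on (K : set V) (alpha : multi_index) (f : X) : X :=
  fun x => lim (mderiv alpha f y @[y --> within K° (nbhs x)]).

Definition smooth_compact (K : set V) : set X :=
  [set f | [/\ restr K f = f, smooth_on K° f,
    forall x, K x -> f y @[y --> within K° (nbhs x)] --> f x &
    forall alpha x, K x -> cvg (mderiv alpha f y @[y --> within K° (nbhs x)])]].

Section WeightedSpace.
Variables (K : regular_compact R d) (w : nat -> R) (w_ge0 : forall j, 0 <= w j).

Definition weighted_values (f : X) : set R :=
  [set r | exists alpha x, rc_set K x /\
     r = `|mderiv_on K alpha f x| / w (mi_length alpha)].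

Definition weighted_carrier : set X :=
  [set f | smooth_compact K f /\ has_ubound (weighted_values f)].

Definition weighted_norm (f : X) : R := sup (weighted_values f).

Let within_proper x : rc_set K x -> ProperFilter (within K° (nbhs x)).
Proof.
move=> Kx; split; last exact: within_filter.
move=> K0; have : closure K° x by rewrite rc_closure.
by move=> /(_ _ K0) [y [Ky /(_ Ky)]].
Qed.

Let mderiv_within alpha (f g : X) (a : R) (x : V) :
  smooth_compact K f -> smooth_compact K g ->
  \forall y \near within K° (nbhs x),
    (a *: mderiv alpha f + mderiv alpha g) y = mderiv alpha (a *: f + g) y.
Proof.
move=> [_ sf _ _] [_ sg _ _]; rewrite near_withinE; near=> y => Ky.
by rewrite /mderiv (iter_partialP (@open_interior _ _) a sf sg).
Unshelve. all: by end_near. Qed.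

Let mderiv_cvg alpha f g (a : R) x : rc_set K x ->
  smooth_compact K f -> smooth_compact K g ->
  mderiv alpha (a *: f + g) y @[y --> within K° (nbhs x)] -->
    a *: mderiv_on K alpha f x + mderiv_on K alpha g x.
Proof.
move=> Kx sf sg; have PF := within_proper Kx.
apply: (cvg_trans (near_eq_cvg (mderiv_within alpha a x sf sg))).
case: (sf) (sg) => _ _ _ cf [_ _ _ cg].
apply: cvgD; last exact: cg.
by apply: cvgZl_tmp; exact: cf.
Qed.

Lemma mderiv_onP alpha f g (a : R) x : rc_set K x ->
  smooth_compact K f -> smooth_compact K g ->
  mderiv_on K alpha (a *: f + g) x =
    a *: mderiv_on K alpha f x + mderiv_on K alpha g x.
Proof.
move=> Kx sf sg; have PF := within_proper Kx.
exact/cvg_lim/mderiv_cvg.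
Qed.

Lemma smooth_compact_subspace : linear_subspace (smooth_compact K).
Proof.
split=> [|a f g sf sg].
  split.
  - exact: (linear0 (restr _)).
  - exact: smooth_on0.
  - by move=> x Kx; have PF := within_proper Kx; exact: cvg_cst.
  - move=> alpha x Kx; have PF := within_proper Kx.
    by rewrite /mderiv iter_partial0; exact: is_cvg_cst.
case: (sf) (sg) => rf of_ ef cf [rg og eg cg]; split.
- by rewrite restr_linear rf rg.
- by apply: smooth_onP => //; exact: open_interior.
- move=> x Kx; have PF := within_proper Kx.
  apply: cvgD; last exact: eg.
  by apply: cvgZl_tmp; exact: ef.
- move=> alpha x Kx; have PF := within_proper Kx.
  by apply/cvg_ex; exists (a *: mderiv_on K alpha f x + mderiv_on K alpha g x);
    exact: mderiv_cvg.
Qed.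

Let mderiv_on0 alpha x : rc_set K x -> mderiv_on K alpha 0 x = 0.
Proof.
move=> Kx; have PF := within_proper Kx.
by rewrite /mderiv_on /mderiv iter_partial0; apply: cvg_lim => //; exact: cvg_cst.
Qed.

Lemma weighted_carrier_subspace : linear_subspace weighted_carrier.
Proof.
split=> [|a f g [sf [B Bf]] [sg [C Cg]]]; split.
- exact: smooth_compact_subspace.1.
- by exists 0 => _ [alpha [x [Kx ->]]]; rewrite mderiv_on0// normr0 mul0r.
- exact: smooth_compact_subspace.2.
exists (`|a| * B + C) => _ [alpha [x [Kx ->]]]; rewrite mderiv_onP//.
have Bx := Bf _ (ex_intro _ alpha (ex_intro _ x (conj Kx erefl))).
have Cx := Cg _ (ex_intro _ alpha (ex_intro _ x (conj Kx erefl))).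
apply: (@le_trans _ _ ((`|a| * `|mderiv_on K alpha f x| +
    `|mderiv_on K alpha g x|) / w (mi_length alpha))).
  by rewrite ler_wpM2r ?invr_ge0// -normrZ; exact: ler_normD.
by rewrite mulrDl -mulrA lerD// ler_wpM2l.
Qed.

Let weighted_values_le f alpha x : weighted_carrier f -> rc_set K x ->
  `|mderiv_on K alpha f x| / w (mi_length alpha) <= weighted_norm f.
Proof. by move=> [_ uf] Kx; apply: ub_le_sup => //; exists alpha, x. Qed.

Let weighted_norm_le f r : weighted_carrier f -> 0 <= r ->
  (forall alpha x, rc_set K x ->
    `|mderiv_on K alpha f x| / w (mi_length alpha) <= r) ->
  weighted_norm f <= r.
Proof.
move=> Cf r0 H; rewrite /weighted_norm.
have [->|/set0P wn0] := eqVneq (weighted_values f) set0; first by rewrite sup0.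
by apply: ge_sup => // _ [alpha [x [Kx ->]]]; exact: H.
Qed.

Let weighted_norm_ge0 f : weighted_carrier f -> 0 <= weighted_norm f.
Proof.
move=> Cf; rewrite /weighted_norm.
have [->|/set0P[r]] := eqVneq (weighted_values f) set0; first by rewrite sup0.
move=> [alpha [x [Kx _]]].
by apply: le_trans (weighted_values_le alpha Cf Kx); rewrite divr_ge0.
Qed.

Lemma weighted_normD f g : weighted_carrier f -> weighted_carrier g ->
  weighted_norm (f + g) <= weighted_norm f + weighted_norm g.
Proof.
move=> Cf Cg; have Cfg : weighted_carrier (f + g).
  by rewrite -[f]scale1r; exact: weighted_carrier_subspace.2.
apply: weighted_norm_le => //; first by rewrite addr_ge0 ?weighted_norm_ge0.
move=> alpha x Kx; rewrite -[f in f + g]scale1r (mderiv_onP _ _ _ Cf.1 Cg.1)// scale1r.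
apply: le_trans (lerD (weighted_values_le alpha Cf Kx)
                      (weighted_values_le alpha Cg Kx)).
by rewrite -mulrDl ler_wpM2r ?invr_ge0// ler_normD.
Qed.

Lemma weighted_normZ (a : R) f : weighted_carrier f ->
  weighted_norm (a *: f) = `|a| * weighted_norm f.
Proof.
have C0 : weighted_carrier 0 by exact: weighted_carrier_subspace.1.
have CZ b g : weighted_carrier g -> weighted_carrier (b *: g).
  by move=> Cg; rewrite -[b *: g]addr0; exact: weighted_carrier_subspace.2.
have le b g : weighted_carrier g ->
    weighted_norm (b *: g) <= `|b| * weighted_norm g.
  move=> Cg; apply: weighted_norm_le; first exact: CZ.
    by rewrite mulr_ge0// weighted_norm_ge0.
  move=> alpha x Kx; rewrite -[b *: g]addr0 (mderiv_onP _ _ _ Cg.1 C0.1)//.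
  by rewrite mderiv_on0// addr0 normrZ -mulrA ler_wpM2l// weighted_values_le.
move=> Cf; apply/eqP; rewrite eq_le le//=.
have [->|a0] := eqVneq a 0; first by rewrite normr0 mul0r; exact/weighted_norm_ge0/CZ.
have := le a^-1 (a *: f) (CZ _ _ Cf).
by rewrite scalerA mulVf// scale1r normfV mulrC ler_pdivlMr ?normr_gt0// mulrC.
Qed.

Definition weighted_lcs : lcs X :=
  seminorm_lcs weighted_carrier_subspace weighted_normD weighted_normZ.

End WeightedSpace.

(* Projective limit over the regular compact subsets of [U], for the restriction
   maps; a compatible family of functions on the [K]'s is the family of
   restrictions of a smooth function on [U]. *)
Definition compact_lim (U : set V) (oU : open U)
    (E : regular_compact R d -> lcs X) : lcs X :=
  proj_lim (smooth_space_subspace oU)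
    (fun K : {K : regular_compact R d | K `<=` U} => E (sval K))
    (fun K => restr (sval K)).

Lemma setT_subspace : linear_subspace [set: X].
Proof. by []. Qed.

(* Projective limit along inclusions, that is the intersection. *)
Definition meet_lim (I : Type) (E : I -> lcs X) : lcs X :=
  proj_lim setT_subspace E (fun=> idfun).

End FunctionSpaces.

Record weight_matrix (R : realType) := WeightMatrix {
  wm_seq :> {posnum R} -> nat -> R ;
  wm_gt0 : forall x j, 0 < wm_seq x j ;
  wm_le : forall x y j, x%:num <= y%:num -> wm_seq x j <= wm_seq y j }.

Section UltradifferentiableClasses.
Context {R : realType} {d : nat} (F : completeNormedModType R).
Variables (U : set 'rV[R]_d) (oU : open U).

Section PilipovicTeofanovTomic.
Variables (tau sigma : R).

(* For [sigma != 0] the value at [j = 0] is 1, since [0 `^ sigma = 0] and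
   [0 `^ 0 = 1]. *)
Definition ptt_weight (h : R) (j : nat) : R :=
  h `^ (j%:R `^ sigma) * j%:R `^ (tau * j%:R `^ sigma).

Lemma ptt_weight_ge0 h j : 0 <= ptt_weight h j.
Proof. by rewrite mulr_ge0// powR_ge0. Qed.

Definition ptt_step (K : regular_compact R d) (h : {posnum R}) :
    lcs ('rV[R]_d -> F) :=
  weighted_lcs K (ptt_weight_ge0 h%:num).

Definition ptt_roumieu : lcs ('rV[R]_d -> F) :=
  compact_lim oU (fun K => ind_lim (fun h => ptt_step K h)).

Definition ptt_beurling : lcs ('rV[R]_d -> F) :=
  compact_lim oU (fun K => meet_lim (fun h => ptt_step K h)).

End PilipovicTeofanovTomic.

Section WeightMatrix.
Variable M : weight_matrix R.

Definition matrix_weight (x : {posnum R}) (h : R) (j : nat) : R :=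
  h ^+ j * M x j.

Lemma matrix_weight_ge0 x (h : {posnum R}) j : 0 <= matrix_weight x h%:num j.
Proof. by rewrite mulr_ge0// ltW// wm_gt0. Qed.

Definition matrix_step (K : regular_compact R d) (x h : {posnum R}) :
    lcs ('rV[R]_d -> F) :=
  weighted_lcs K (matrix_weight_ge0 x h).

Definition matrix_roumieu : lcs ('rV[R]_d -> F) :=
  compact_lim oU (fun K => ind_lim (fun x => ind_lim (fun h =>
    matrix_step K x h))).

Definition matrix_beurling : lcs ('rV[R]_d -> F) :=
  compact_lim oU (fun K => meet_lim (fun x => meet_lim (fun h =>
    matrix_step K x h))).

End WeightMatrix.

End UltradifferentiableClasses.

Section PowerMatrix.
Context {R : realType} (tau sigma : R) (sigma1 : 1 < sigma).

Definition power_seq (c : {posnum R}) (j : nat) : R :=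
  c%:num `^ (j%:R `^ sigma) * j%:R `^ (tau * j%:R `^ sigma).

Fact power_seq_gt0 c j : 0 < power_seq c j.
Proof.
apply: mulr_gt0; first exact: powR_gt0.
case: j => [|j]; last exact: powR_gt0.
have s0 : sigma != 0 by rewrite gt_eqF// (lt_trans _ sigma1).
by rewrite (powR0 s0) mulr0 powRr0.
Qed.

Fact power_seq_le c c' j : c%:num <= c'%:num -> power_seq c j <= power_seq c' j.
Proof.
move=> cc; rewrite ler_wpM2r ?powR_ge0//.
by apply: ge0_ler_powR; rewrite ?powR_ge0// nnegrE.
Qed.

Definition power_matrix : weight_matrix R :=
  WeightMatrix power_seq_gt0 power_seq_le.

End PowerMatrix.

(* Main.v *)
Require Import Defs.
From mathcomp Require Import all_boot all_order all_algebra.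
From mathcomp Require Import all_classical all_reals all_analysis.
Import Order.TTheory GRing.Theory Num.Theory.
Import numFieldNormedType.Exports.
Local Open Scope classical_set_scope.
Local Open Scope ring_scope.

(** For a natural number [j] one has [j <= j ^ sigma], so the geometric factor
  [h ^ j] is absorbed in [c ^ (j ^ sigma)] by a change of [c]:
  [h ^ j * c ^ (j ^ sigma) <= (c * max h 1) ^ (j ^ sigma)] and
  [(c * min h 1) ^ (j ^ sigma) <= h ^ j * c ^ (j ^ sigma)].  Hence on each
  compact set the two systems of weighted spaces are cofinal in each other. *)

Lemma cont_incl_anti {R : realType} {X : lmodType R} (E F : lcs X) :
  cont_incl E F -> cont_incl F E -> E = F.
Proof. by move=> [EF FE] [FE' EF']; apply: lcs_eq; apply/seteqP. Qed.

Lemma cont_incl_refl {R : realType} {X : lmodType R} (E : lcs X) :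
  cont_incl E E.
Proof. by split. Qed.

Lemma cont_incl_trans {R : realType} {X : lmodType R} (F E G : lcs X) :
  cont_incl E F -> cont_incl F G -> cont_incl E G.
Proof.
by move=> [EF FE] [FG GF]; split; [exact: subset_trans FG|exact: subset_trans FE].
Qed.

(** This is the universal property applied to the identity inclusion of the limit. *)
Lemma cont_incl_ind_lim {R : realType} {X : lmodType R} {I : Type}
    (E : I -> lcs X) (i : I) : cont_incl (E i) (ind_lim E).
Proof. by have /ind_limP := cont_incl_refl (ind_lim E). Qed.

(** The linking maps are identities and the ambient subspace is everything, so the conditions of
    [proj_limP] unfold to [cont_incl]. *)
Lemma meet_limP {R : realType} {d : nat} {F : completeNormedModType R}
    {I : Type} (E : I -> lcs ('rV[R]_d -> F)) (G : lcs ('rV[R]_d -> F)) :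
  cont_incl G (meet_lim E) <-> forall i, cont_incl G (E i).
Proof. exact: proj_limP. Qed.

Lemma cont_incl_meet_lim {R : realType} {d : nat}
    {F : completeNormedModType R} {I : Type}
    (E : I -> lcs ('rV[R]_d -> F)) (i : I) : cont_incl (meet_lim E) (E i).
Proof. by have /meet_limP := cont_incl_refl (meet_lim E). Qed.

(** Dividing by a larger weight lowers every quotient, so the inclusion does not increase the norm.
    Strict positivity of [v] matters because a quotient by 0 is 0. *)
Lemma weighted_lcs_le {R : realType} {d : nat} {F : completeNormedModType R}
    (K : regular_compact R d) (v w : nat -> R)
    (v_ge0 : forall j, 0 <= v j) (w_ge0 : forall j, 0 <= w j) :
  (forall j, 0 < v j) -> (forall j, v j <= w j) ->
  cont_incl (weighted_lcs (F := F) K v_ge0) (weighted_lcs K w_ge0).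
Proof.
move=> v_gt0 vw.
have val_le (f : 'rV[R]_d -> F) alpha x :
    `|mderiv_on K alpha f x| / w (mi_length alpha) <=
    `|mderiv_on K alpha f x| / v (mi_length alpha).
  by rewrite ler_wpM2l// lef_pV2// posrE// (lt_le_trans _ (vw _)).
have car : weighted_carrier (F := F) K v `<=` weighted_carrier K w.
  move=> f [sf [B fB]]; split=> //; exists B => _ [alpha [x [Kx ->]]].
  by apply: le_trans (val_le _ _ _) _; apply: fB; exists alpha, x.
split=> // N [e e0 eN]; exists e => // f [Cf fe]; apply: eN; split; first exact: car.
apply: le_lt_trans fe.
(* [ge_sup] needs a nonempty set. The two value sets have the same indices [alpha], [x], so they are
   empty together, and then both norms are the default [sup set0]. *)
have [w0|/set0P wn0] := eqVneq (weighted_values K w f) set0.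
  suff v0 : weighted_values K v f = set0 by rewrite /weighted_norm w0 v0.
  apply/seteqP; split=> // r [alpha [x [Kx _]]].
  suff : set0 (`|mderiv_on K alpha f x| / w (mi_length alpha)) by [].
  by rewrite -w0; exists alpha, x.
apply: ge_sup => // _ [alpha [x [Kx ->]]].
apply: le_trans (val_le _ _ _) _.
by apply: ub_le_sup; [exact: Cf.2|exists alpha, x].
Qed.

(** Integrality matters, as the bound fails on the open interval from 0 to 1: a nonzero [j] is at
    least 1, where powers grow with the exponent. *)
Lemma nat_le_powR {R : realType} (j : nat) (s : R) :
  1 < s -> j%:R <= j%:R `^ s.
Proof.
case: j => [|j] s1; first exact: powR_ge0.
by rewrite -[leLHS]powRr1// ler_powR ?ler1n// ltW.
Qed.

Lemma exprn_le_powR {R : realType} (j : nat) {s h : R} :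
  1 < s -> 1 <= h -> h ^+ j <= h `^ (j%:R `^ s).
Proof.
move=> s1 h1; rewrite -powR_mulrn; last exact: le_trans h1.
by rewrite ler_powR// nat_le_powR.
Qed.

Lemma powR_le_exprn {R : realType} (j : nat) {s h : R} :
  1 < s -> 0 < h -> h <= 1 -> h `^ (j%:R `^ s) <= h ^+ j.
Proof.
move=> s1 h0 h1; rewrite -powR_mulrn; last exact: ltW.
by rewrite ger_powR ?h0// nat_le_powR.
Qed.

Section Weights.
Context {R : realType} {tau sigma : R} (sigma1 : 1 < sigma).
Local Notation M := (power_matrix tau sigma1).

Lemma matrix_weight_gt0 (W : weight_matrix R) (c h : {posnum R}) j :
  0 < matrix_weight W c h%:num j.
Proof. by rewrite mulr_gt0// ?exprn_gt0// wm_gt0. Qed.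

Lemma ptt_weight_gt0 (c : {posnum R}) j : 0 < ptt_weight tau sigma c%:num j.
Proof. exact: (power_seq_gt0 tau sigma1 c j). Qed.

Lemma matrix_weight1 (c : {posnum R}) j :
  matrix_weight M c 1 j = ptt_weight tau sigma c%:num j.
Proof. by rewrite /matrix_weight expr1n mul1r. Qed.

(** The maximum with 1 puts the base where raising the exponent from [j] to [j ^ sigma] enlarges the
    power. *)
Lemma matrix_weight_le_ptt (c h : {posnum R}) j :
  matrix_weight M c h%:num j <=
  ptt_weight tau sigma (c%:num * Num.max h%:num 1) j.
Proof.
rewrite /matrix_weight /= /power_seq /ptt_weight mulrA ler_wpM2r ?powR_ge0//.
rewrite powRM ?le_max ?ler01 ?orbT// mulrC ler_wpM2l ?powR_ge0//.
apply: le_trans _ (exprn_le_powR j sigma1 _); last by rewrite le_max lexx orbT.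
by rewrite lerXn2r ?nnegrE ?le_max ?lexx ?ler01 ?orbT.
Qed.

(** For a base at most 1 the larger exponent gives the smaller power, hence the minimum. *)
Lemma ptt_le_matrix_weight (c h : {posnum R}) j :
  ptt_weight tau sigma (c%:num * Num.min h%:num 1) j <=
  matrix_weight M c h%:num j.
Proof.
have m0 : 0 < Num.min h%:num 1 by rewrite lt_min ltr01 andbT.
rewrite /matrix_weight /= /power_seq /ptt_weight mulrA ler_wpM2r ?powR_ge0//.
rewrite powRM// ?(ltW m0)// mulrC ler_wpM2r ?powR_ge0//.
apply: le_trans (powR_le_exprn j sigma1 m0 _) _; first by rewrite ge_min lexx orbT.
by rewrite lerXn2r ?nnegrE ?(ltW m0)// ge_min lexx.
Qed.

Context {d : nat} (F : completeNormedModType R) (K : regular_compact R d).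

Lemma ptt_roumieu_step :
  ind_lim (fun h => ptt_step F tau sigma K h) =
  ind_lim (fun c => ind_lim (fun h => matrix_step F M K c h)).
Proof.
apply: cont_incl_anti; apply/ind_limP => c.
  (* With [h = 1] the geometric factor disappears and the weights coincide. *)
  apply: cont_incl_trans (cont_incl_ind_lim _ c).
  apply: cont_incl_trans (cont_incl_ind_lim _ 1%:pos).
  apply: weighted_lcs_le => j; first exact: ptt_weight_gt0.
  by rewrite matrix_weight1.
apply/ind_limP => h.
apply: cont_incl_trans (cont_incl_ind_lim _ (c%:num * Num.max h%:num 1)%:pos).
apply: weighted_lcs_le => j; first exact: matrix_weight_gt0.
exact: matrix_weight_le_ptt.
Qed.

Lemma ptt_beurling_step :
  meet_lim (fun h => ptt_step F tau sigma K h) =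
  meet_lim (fun c => meet_lim (fun h => matrix_step F M K c h)).
Proof.
apply: cont_incl_anti; apply/meet_limP => c.
  apply/meet_limP => h.
  (* A projective limit lies in all its steps, so a step with a smaller weight is chosen. *)
  apply: cont_incl_trans (cont_incl_meet_lim _ (c%:num * Num.min h%:num 1)%:pos) _.
  apply: weighted_lcs_le => j; first exact: ptt_weight_gt0.
  exact: ptt_le_matrix_weight.
apply: cont_incl_trans (cont_incl_meet_lim _ c) _.
apply: cont_incl_trans (cont_incl_meet_lim _ 1%:pos) _.
apply: weighted_lcs_le => j; first exact: matrix_weight_gt0.
by rewrite matrix_weight1.
Qed.

End Weights.

Theorem proposition5p1 (R : realType) (d : nat) (F : completeNormedModType R)
    (U : set 'rV[R]_d) (oU : open U) (tau sigma : R)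
    (tau_gt0 : 0 < tau) (sigma_gt1 : 1 < sigma) :
  ptt_roumieu F oU tau sigma = matrix_roumieu F oU (power_matrix tau sigma_gt1)
  /\
  ptt_beurling F oU tau sigma = matrix_beurling F oU (power_matrix tau sigma_gt1).
Proof.
(* Both classes are the same limit over compact sets, so the comparison is made on each [K]. *)
split; congr compact_lim; apply/funext => K.
  exact: ptt_roumieu_step.
exact: ptt_beurling_step.
Qed.
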